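(* For every integer $d\ge4$, there exists a finite connected irregular (i.e. not regular) simple graph $G$ satisfying $\mathrm{CD}(2,\infty)$ and $\lambda_1(G)=2$ such that $G_{\mathrm{vis}}$ is $d$-regular and $G_{\mathrm{vis}}\not\cong H_d$.
   Context: All graphs are finite, simple and unweighted. The (non-normalized) Laplacian is $Lh(x)=\sum_{y\sim x}(h(y)-h(x))$; the eigenvalues of $-L$ on a connected graph are $0=\lambda_0<\lambda_1\le\lambda_2\le\cdots$ with multiplicity. For functions $f,g:V\to\mathbb R$, $\Gamma(f,g)(x)=\frac12\sum_{y\sim x}(f(y)-f(x))(g(y)-g(x))$, $\Gamma_2(f,g)=\frac12(L\Gamma(f,g)-\Gamma(g,Lf)-\Gamma(f,Lg))$, $\Gamma(f)=\Gamma(f,f)$, $\Gamma_2(f)=\Gamma_2(f,f)$. $G$ satisfies $\mathrm{CD}(K,\infty)$ if $\Gamma_2(f)(x)\ge K\,\Gamma(f)(x)$ for all $f:V\to\mathbb R$ and all $x\in V$. Put $E_2(G)=\ker(L+2I)$. An edge $xy$ of $G$ is visible if some $a\in E_2(G)$ has $a(x)\ne a(y)$. $G_{\mathrm{vis}}$ is the spanning subgraph of $G$ whose edges are the visible edges. $H_d$ is the $d$-dimensional hypercube graph on $\mathbb F_2^d$ (two vertices adjacent iff they differ in exactly one coordinate). *)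

(* Defs.v *)
From HB Require Import structures.
From mathcomp Require Import all_boot all_order all_algebra.
From mathcomp Require Import boolp reals.

Set Implicit Arguments.
Unset Strict Implicit.
Unset Printing Implicit Defensive.

Import Order.TTheory GRing.Theory Num.Theory.
Local Open Scope ring_scope.

Record sgraph := SGraph {
  vertex :> finType;
  edge : rel vertex;
  edge_sym : symmetric edge;
  edge_irr : irreflexive edge
}.

Definition neighbours (G : sgraph) (x : G) : {set G} := [set y | edge x y].

Definition regular (G : sgraph) (d : nat) : Prop :=
  forall x : G, #|neighbours x| = d.

Definition irregular (G : sgraph) : Prop := ~ exists d, regular G d.

Definition graph_connected (G : sgraph) : Prop :=
  (0 < #|G|)%N /\ forall x y : G, connect (@edge G) x y.

Definition graph_iso (G H : sgraph) : Prop :=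
  exists2 f : G -> H, bijective f & {mono f : x y / edge x y}.

Definition cube_edge (d : nat) (x y : 'rV['F_2]_d) : bool :=
  #|[set i | x 0 i != y 0 i]| == 1%N.

Lemma cube_edge_sym d : symmetric (@cube_edge d).
Proof.
by move=> x y; congr (#|pred_of_set _| == _); apply/setP => i; rewrite !inE eq_sym.
Qed.

Lemma cube_edge_irr d : irreflexive (@cube_edge d).
Proof.
move=> x; rewrite /cube_edge (_ : [set _ | _] = set0) ?cards0 //.
by apply/setP => i; rewrite !inE eqxx.
Qed.

Definition hypercube (d : nat) : sgraph :=
  SGraph (@cube_edge_sym d) (@cube_edge_irr d).

Section Laplacian.
Variables (R : realType) (G : sgraph).
Implicit Types (f g h : G -> R) (x y : G).

Definition Lap h x : R := \sum_(y | edge x y) (h y - h x).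

Definition Gamma f g x : R :=
  2^-1 * \sum_(y | edge x y) (f y - f x) * (g y - g x).

Definition Gamma2 f g x : R :=
  2^-1 * (Lap (Gamma f g) x - Gamma g (Lap f) x - Gamma f (Lap g) x).

(* The curvature-dimension condition CD(K, oo). *)
Definition CD_infty (K : R) : Prop :=
  forall f x, K * Gamma f f x <= Gamma2 f f x.

(* The matrix of -L, acting on column vectors, in the basis of indicator
   functions of the vertices. *)
Definition neg_Lap_mx : 'M[R]_#|G| :=
  \matrix_(i, j) - Lap (fun x => (x == enum_val j)%:R) (enum_val i).

(* s lists the eigenvalues of -L with multiplicity, in nondecreasing order. *)
Definition Lap_spectrum (s : seq R) : Prop :=
  sorted <=%R s /\ char_poly neg_Lap_mx = \prod_(a <- s) ('X - a%:P).

(* The relation "lambda_k(G) = v"; functional in v by is_lambda_uniq. *)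
Definition is_lambda (k : nat) (v : R) : Prop :=
  exists s, [/\ Lap_spectrum s, (k < size s)%N & s`_k = v].

Lemma is_lambda_uniq k v w : is_lambda k v -> is_lambda k w -> v = w.
Proof.
move=> [s [[ss es] _ <-]] [t [[st et] _ <-]]; congr (_`_k).
apply: (sorted_eq le_trans le_anti) => //.
by apply: prod_XsubC_eq; rewrite -es -et.
Qed.

Definition E2 (a : G -> R) : Prop := forall x, Lap a x + 2 * a x = 0.

Definition vis_edge x y : bool :=
  edge x y && `[< exists2 a, E2 a & a x <> a y >].

Lemma vis_edge_sym : symmetric vis_edge.
Proof.
move=> x y; rewrite /vis_edge edge_sym; congr (_ && _).
by apply/asboolP/asboolP => -[a Ea axy]; exists a => // /esym.
Qed.

Lemma vis_edge_irr : irreflexive vis_edge.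
Proof. by move=> x; rewrite /vis_edge edge_irr. Qed.

Definition Gvis : sgraph := SGraph vis_edge_sym vis_edge_irr.

End Laplacian.

(* Main.v *)
(** If [G] satisfies CD(2,oo) and all its nonzero eigenvalues are at least 2,
    then so does the prism [K_2 x G], which moreover has 2 as an eigenvalue.
    On a connected [G], the functions of [E2] on the prism are the functions
    of [E2] on [G], lifted to both layers, plus multiples of the sign of the
    layer: so the visible edges of the prism are the lifts of the visible edges
    of [G] together with all the edges joining the two layers, and the visible
    degree increases by exactly 1.

    Start from [K_5] minus an edge: it is irregular, it satisfies CD(2,oo), and
    its spectrum is 0, 3, 5, 5, 5, so that it has no visible edge. After [d]
    prisms the visible graph is [d]-regular on [5 * 2 ^ d] vertices (it is a
    union of five [d]-cubes), whereas the [d]-cube has [2 ^ d] vertices. *)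
Require Import Defs.
From mathcomp Require Import all_boot all_order all_algebra.
From mathcomp Require Import boolp reals.
From mathcomp Require Import perm ring lra.

Set Implicit Arguments.
Unset Strict Implicit.
Unset Printing Implicit Defensive.

Import Order.TTheory GRing.Theory Num.Theory.
Local Open Scope ring_scope.

(** * Calculus of [Gamma] and harmonic functions *)

Section GammaCalculus.
Variables (R : realType) (G : sgraph).
Implicit Types (f g h w : G -> R) (x : G).

Lemma LapD g h x : Lap (fun y => g y + h y) x = Lap g x + Lap h x.
Proof. by rewrite /Lap -big_split; apply: eq_bigr => y _ /=; ring. Qed.

Lemma LapZ c h x : Lap (fun y => c * h y) x = c * Lap h x.
Proof. by rewrite /Lap mulr_sumr; apply: eq_bigr => y _; ring. Qed.

Lemma GammaC f g x : Gamma f g x = Gamma g f x.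
Proof. by congr (_ * _); apply: eq_bigr => y _; rewrite mulrC. Qed.

Lemma GammaDr f g h x :
  Gamma f (fun y => g y + h y) x = Gamma f g x + Gamma f h x.
Proof.
by rewrite /Gamma -mulrDr -big_split; congr (_ * _); apply: eq_bigr => y _ /=; ring.
Qed.

Lemma GammaDl f g h x :
  Gamma (fun y => g y + h y) f x = Gamma g f x + Gamma h f x.
Proof. by rewrite GammaC GammaDr !(GammaC f). Qed.

Lemma Gamma_ge0 f x : 0 <= Gamma f f x.
Proof.
by rewrite mulr_ge0 ?invr_ge0 ?ler0n ?sumr_ge0 // => y _; rewrite -expr2 sqr_ge0.
Qed.

Lemma Lap_sqr w x :
  Lap (fun y => w y ^+ 2) x = 2 * (w x * Lap w x) + 2 * Gamma w w x.
Proof.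
rewrite /Gamma (mulrA 2 2^-1) divff ?pnatr_eq0 // mul1r /Lap !mulr_sumr -big_split.
by apply: eq_bigr => y _ /=; ring.
Qed.

(** Maximum principle: at a maximum of [h] the differences to the neighbours all have one sign and
    sum to zero, so the set of maxima is closed under adjacency. *)
Lemma harmonic_const h : graph_connected G -> (forall x, Lap h x = 0) ->
  forall x y, h x = h y.
Proof.
move=> [/card_gt0P[x0 _] conn] Lh0.
have [m _ hm] := arg_maxP h (erefl : xpredT x0).
suff hE x : h x = h m by move=> x y; rewrite !hE.
have clos : closed (@edge G) [pred z | h z == h m].
  apply: intro_closed => [|y z]; first exact/sym_connect_sym/edge_sym.
  rewrite !inE => yz /eqP hy.
  have ge0 t : edge y t -> 0 <= h y - h t by move=> _; rewrite subr_ge0 hy; exact: hm.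
  have sum0 : \sum_(t | edge y t) (h y - h t) = 0.
    transitivity (- Lap h y); last by rewrite Lh0 oppr0.
    by rewrite /Lap -sumrN; apply: eq_bigr => t _; rewrite opprB.
  by rewrite -hy eq_sym -subr_eq0 (psumr_eq0P ge0 sum0).
by have := closed_connect clos (conn m x); rewrite !inE eqxx => /esym/eqP.
Qed.

End GammaCalculus.

(** * The prism: degrees, curvature and visible edges *)

Section Prism.
Variable G : sgraph.

Definition prism_edge (p q : bool * G) : bool :=
  if p.1 == q.1 then edge p.2 q.2 else p.2 == q.2.

Lemma prism_edge_sym : symmetric prism_edge.
Proof.
move=> p q; rewrite /prism_edge (eq_sym q.1).
by case: ifP => _; [exact: edge_sym | exact: eq_sym].
Qed.

Lemma prism_edge_irr : irreflexive prism_edge.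
Proof. by move=> p; rewrite /prism_edge eqxx edge_irr. Qed.

Definition prism : sgraph := SGraph prism_edge_sym prism_edge_irr.

(** Values lie in any [nmodType], so that one splitting serves Laplacians over [R] and, in [nat],
    degrees. *)
Lemma prism_sum (V : nmodType) (F : bool * G -> V) b x :
  \sum_(p | prism_edge (b, x) p) F p =
  \sum_(y | edge x y) F (b, y) + F (~~ b, x).
Proof.
have -> : \sum_(p | prism_edge (b, x) p) F p =
    \sum_(c : bool) \sum_(y | prism_edge (b, x) (c, y)) F (c, y).
  by rewrite pair_big_dep; apply: eq_big => [[]|[]].
rewrite big_bool; case: b; last rewrite addrC; congr (_ + _);
  by rewrite (big_pred1 x) // => y; rewrite /prism_edge /= eq_sym.
Qed.

Lemma card_prism_neighbours (p : prism) :
  #|neighbours p| = #|neighbours p.2|.+1.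
Proof.
case: p => b x; rewrite !cardsE -!sum1_card.
exact: etrans (@prism_sum nat (fun=> 1%N) b x) (addn1 _).
Qed.

Lemma prism_irregular : irregular G -> irregular prism.
Proof.
move=> irrG [k regk]; apply: irrG; exists k.-1 => x.
by rewrite -(regk (true, x)) card_prism_neighbours.
Qed.

Lemma prism_connected : graph_connected G -> graph_connected prism.
Proof.
move=> [G_gt0 conn]; split; first by rewrite card_prod card_bool muln_gt0.
have layer b x y : connect (@edge prism) (b, x) (b, y).
  have /connectP[p pth ->] := conn x y.
  elim: p x pth => [|z p IHp] x /=; first by rewrite connect0.
  case/andP=> xz /IHp; apply: connect_trans; apply: connect1.
  by rewrite /= /prism_edge eqxx.
move=> [b x] [c y]; apply: connect_trans (layer b x y) _.
have [->|/negPf bc] := eqVneq b c; first exact: connect0.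
by apply: connect1; rewrite /= /prism_edge /= bc.
Qed.

Section Curvature.
Variable R : realType.
Implicit Types f g : prism -> R.

Lemma prism_Lap f b x :
  Lap f (b, x) = Lap (fun y => f (b, y)) x + (f (~~ b, x) - f (b, x)).
Proof. exact: prism_sum. Qed.

Lemma prism_Gamma f g b x :
  Gamma f g (b, x) = Gamma (fun y => f (b, y)) (fun y => g (b, y)) x +
    2^-1 * ((f (~~ b, x) - f (b, x)) * (g (~~ b, x) - g (b, x))).
Proof. by rewrite /Gamma [X in _ * X]prism_sum mulrDr. Qed.

(** The joining edge adds half of [w ^+ 2] to [Gamma f f]. In the expansion the terms in
    [w x * Lap w x] and in [Gamma u w x] cancel, and only nonnegative corrections remain. *)
Lemma prism_Gamma2 f b x :
  let u := fun y => f (b, y) in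
  let w := fun y => f (~~ b, y) - f (b, y) in
  Gamma2 f f (b, x) = Gamma2 u u x + Gamma w w x + w x ^+ 2.
Proof.
move=> u w; pose v y := u y + w y.
have vE : (fun y => f (~~ b, y)) = v by apply/funext => y; rewrite /v /u /w subrKC.
have uE y : f (b, y) = u y by [].
have fE y : f (~~ b, y) = v y by rewrite -vE.
have GE : (fun y => Gamma f f (b, y)) =
    (fun y => Gamma u u y + 2^-1 * w y ^+ 2).
  by apply/funext => y; rewrite prism_Gamma expr2.
have LE : (fun y => Lap f (b, y)) = (fun y => Lap u y + w y).
  by apply/funext => y; rewrite prism_Lap.
have L'E : Lap f (~~ b, x) = Lap u x + Lap w x - w x.
  by rewrite prism_Lap negbK vE LapD /v uE fE /v; ring.
(* Forgetting the body of [w] keeps it a single atom in the bilinear expansion of [v = u + w]. *)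
clearbody w.
rewrite /Gamma2 (GammaC f) [Lap (Gamma _ _) _]prism_Lap GE.
rewrite (LapD (Gamma u u)) (LapZ _ (fun y => w y ^+ 2)) Lap_sqr.
rewrite !prism_Gamma negbK vE LE -/u !GammaDl !GammaDr.
rewrite L'E uE fE (prism_Lap f b) -/u fE uE /v (GammaC (Lap u) u) (GammaC w u).
by field.
Qed.

(** Twice the share of the joining edge in [Gamma f f] is exactly the square in [prism_Gamma2]; the
    rest is the bound on one layer plus a nonnegative [Gamma]. *)
Lemma prism_CD2 : CD_infty G (2 : R) -> CD_infty prism (2 : R).
Proof.
move=> cdG f [b x]; rewrite prism_Gamma2 prism_Gamma.
have := cdG (fun y => f (b, y)) x.
have := Gamma_ge0 (fun y => f (~~ b, y) - f (b, y)) x.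
lra.
Qed.

Lemma prism_E2_lift (a : G -> R) : E2 a -> @E2 R prism (fun p => a p.2).
Proof. by move=> Ea [b x]; rewrite prism_Lap /= subrr addr0 Ea. Qed.

Lemma prism_E2_sign : @E2 R prism (fun p => (-1) ^+ p.1).
Proof.
move=> [b x]; rewrite prism_Lap /= [Lap _ _]big1 => [|y _]; last by rewrite subrr.
by case: b => /=; ring.
Qed.

(** On each layer the equation reads: Laplacian of that layer plus the sum of both layers is zero.
    Adding the two equations gives [E2] for the sum; subtracting them makes the difference harmonic,
    hence constant. *)
Lemma prism_E2_layers (a : prism -> R) : graph_connected G -> E2 a ->
  E2 (fun x => a (true, x) + a (false, x)) /\
  forall x y, a (true, x) - a (false, x) = a (true, y) - a (false, y).
Proof.
move=> conn Ea.
have Et x := Ea (true, x); have Ef x := Ea (false, x).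
split=> [x|].
  by move: (Et x) (Ef x); rewrite LapD !prism_Lap /=; lra.
apply: (@harmonic_const R G (fun x => a (true, x) - a (false, x))) => // x.
have -> : (fun x => a (true, x) - a (false, x)) =
          (fun x => a (true, x) + (-1) * a (false, x)).
  by apply/funext => y; rewrite mulN1r.
by move: (Et x) (Ef x); rewrite LapD LapZ !prism_Lap /=; lra.
Qed.

End Curvature.
End Prism.

Lemma prism_vis_edge (R : realType) (G : sgraph) : graph_connected G ->
  @vis_edge R (prism G) =2 @prism_edge (Gvis R G).
Proof.
move=> conn [b x] [c y]; rewrite /vis_edge /= /prism_edge /=.
case: (eqVneq b c) => [<-|bc]; last first.
  case: (eqVneq x y) => //= <-; apply/asboolP.
  exists (fun p : prism G => (-1) ^+ p.1); first exact: prism_E2_sign.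
  by move=> /=; case: b c bc => -[] //= _; rewrite ?expr0 ?expr1; lra.
rewrite /vis_edge; congr (_ && _); apply/asboolP/asboolP => -[a Ea axy].
  have [Es td] := prism_E2_layers conn Ea.
  (* As the difference of the layers is constant, a sum equal at [x] and [y] would make [a] equal
     there on each layer. *)
  exists (fun z => a (true, z) + a (false, z)) => // sxy; apply: axy.
  by move: (td x y) sxy; case: b; lra.
by exists (fun p : prism G => a p.2) => //; exact: prism_E2_lift.
Qed.

Lemma prism_vis_regular (R : realType) (G : sgraph) k : graph_connected G ->
  regular (Gvis R G) k -> regular (Gvis R (prism G)) k.+1.
Proof.
move=> conn regk p; rewrite -(regk p.2).
rewrite -(@card_prism_neighbours (Gvis R G) p); apply: eq_card => q.
by rewrite !inE; exact: prism_vis_edge.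
Qed.

(** * Characteristic polynomials and the spectrum of the prism *)

Section Spectrum.
Variable R : realType.

(** The two matrices differ by one permutation of both rows and columns, whose signs cancel. This
    frees later computations from [enum_val]. *)
Lemma char_poly_reindex (T : finType) n m (e : 'I_n -> T) (e' : 'I_m -> T)
    (M : T -> T -> R) : bijective e -> bijective e' ->
  char_poly (\matrix_(i, j) M (e i) (e j)) =
  char_poly (\matrix_(i, j) M (e' i) (e' j)).
Proof.
move=> be be'.
have nm : n = m by rewrite -(card_ord n) -(card_ord m) (bij_eq_card be) (bij_eq_card be').
case: m / nm e' be' => e' [f' e'K f'K].
have s_inj : injective (f' \o e).
  by apply: inj_comp; [exact: can_inj f'K | exact: bij_inj].
pose s := perm s_inj.
have e's i : e' (s i) = e i by rewrite permE /= f'K.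
set A' := (\matrix_(i, j) M (e' i) (e' j)).
rewrite /char_poly.
have -> : char_poly_mx (\matrix_(i, j) M (e i) (e j)) =
    row_perm s (col_perm s (char_poly_mx A')).
  by apply/matrixP => i j; rewrite !mxE !e's (inj_eq perm_inj).
by rewrite row_permE col_permE !det_mulmx !det_perm mulrCA -signr_addb odd_permV addbb mulr1.
Qed.

Definition neg_Lap_entry (G : sgraph) (x y : G) : R :=
  - Lap (fun z => (z == y)%:R) x.

Lemma neg_Lap_char_poly (G : sgraph) n (e : 'I_n -> G) : bijective e ->
  char_poly (neg_Lap_mx R G) =
  char_poly (\matrix_(i, j) neg_Lap_entry (e i) (e j)).
Proof. by move=> be; rewrite -(char_poly_reindex _ (@enum_val_bij G)). Qed.

(** Adding the second block row to the first, then subtracting the first block column from the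
    second, makes the matrix block triangular. *)
Lemma det_block_swap (S : comNzRingType) n (B : 'M[S]_n) :
  \det (block_mx B 1%:M 1%:M B) = \det (B + 1%:M) * \det (B - 1%:M).
Proof.
have E : block_mx 1%:M 1%:M 0 1%:M *m block_mx B 1%:M 1%:M B *m
    block_mx 1%:M (- 1%:M) 0 1%:M = block_mx (B + 1%:M) 0 1%:M (B - 1%:M).
  rewrite !mulmx_block !mul1mx !mulmx1 !mul0mx !mulmx0 !add0r !addr0.
  by rewrite !mulmxN !mulmx1 (addrC 1%:M B) addNr (addrC _ B).
rewrite -[RHS](det_lblock _ 1%:M) -E !det_mulmx !det_ublock !det1.
by rewrite !mul1r !mulr1.
Qed.

Lemma prism_neg_Lap_entry (G : sgraph) (p q : prism G) :
  neg_Lap_entry p q =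
  if p.1 == q.1 then neg_Lap_entry p.2 q.2 + (p.2 == q.2)%:R
  else - (p.2 == q.2)%:R.
Proof.
case: p q => b x [c y]; rewrite /neg_Lap_entry prism_Lap /=.
have -> : (fun z => ((b, z) == (c, y))%:R : R) =
    (fun z => if b == c then (z == y)%:R else 0).
  by apply/funext => z; rewrite xpair_eqE; case: ifP.
rewrite !xpair_eqE; case: b c => -[] /=; rewrite ?sub0r ?subr0 ?opprD ?opprK //;
  by rewrite [Lap _ _]big1 ?subr0 ?oppr0 ?sub0r.
Qed.

Lemma prism_char_poly (G : sgraph) :
  let chi := char_poly (neg_Lap_mx R G) in
  char_poly (neg_Lap_mx R (prism G)) = chi * (chi \Po ('X - 2%:P)).
Proof.
set A := neg_Lap_mx R G; set n := #|G| => /=.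
pose lay (s : 'I_n + 'I_n) : prism G :=
  match s with inl i => (false, enum_val i) | inr i => (true, enum_val i) end.
(* Listing one layer after the other puts -L of the prism in block form: [A + 1] on the diagonal,
   [-1] off it. *)
pose e (i : 'I_(n + n)) := lay (split i).
have eE s : e (unsplit s) = lay s by rewrite /e unsplitK.
have e_bij : bijective e.
  apply: inj_card_bij; last by rewrite card_prod card_bool card_ord mul2n addnn.
  apply: inj_comp; last exact: can_inj (@splitK n n).
  by case=> i [] j // [] /enum_val_inj ->.
rewrite (neg_Lap_char_poly e_bij) /char_poly.
have -> : char_poly_mx (\matrix_(i, j) neg_Lap_entry (e i) (e j)) =
    block_mx (char_poly_mx A - 1%:M) 1%:M 1%:M (char_poly_mx A - 1%:M).
  apply/matrixP => i j; rewrite -[i]splitK -[j]splitK.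
  have AE k l : A k l = neg_Lap_entry (enum_val k) (enum_val l) by rewrite mxE.
  case: (split i) => k; case: (split j) => l;
    rewrite ?block_mxEul ?block_mxEur ?block_mxEdl ?block_mxEdr ![in LHS]mxE;
    rewrite !eE prism_neg_Lap_entry /= (inj_eq enum_val_inj);
    rewrite ?eq_lshift ?eq_rshift ?eq_lrshift ?eq_rlshift;
    by rewrite !mxE ?AE ?polyCD ?polyCN ?polyC_natr ?opprD ?opprK ?addrA ?mul0rn ?add0r.
rewrite det_block_swap subrK; congr (_ * _).
rewrite -[RHS]det_map_mx; congr (\det _).
apply/matrixP => i j; rewrite !mxE rmorphB rmorphMn /= comp_polyX comp_polyC.
rewrite mulrnBl polyC_natr.
by case: (i == j); rewrite /= ?mulr1n ?mulr0n; ring.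
Qed.

Lemma char_poly_diagonalizable n (A P : 'M[R]_n) (d : 'rV[R]_n) :
  P \in unitmx -> A *m P = P *m diag_mx d ->
  char_poly A = \prod_i ('X - (d 0 i)%:P).
Proof.
move=> uP AP.
have -> : \prod_i ('X - (d 0 i)%:P) = char_poly (diag_mx d).
  rewrite char_poly_trig ?diag_mx_is_trig //.
  by apply: eq_bigr => i _; rewrite mxE eqxx.
(* Instead of inverting [P], both sides are multiplied by its determinant, a nonzero constant
   polynomial. *)
rewrite /char_poly; apply: (@mulIf _ (\det (map_mx polyC P))).
  by rewrite det_map_mx polyC_eq0 -unitfE -unitmxE.
rewrite -det_mulmx mulrC -det_mulmx /char_poly_mx mulmxBl mulmxBr.
by rewrite -!map_mxM AP mul_scalar_mx mul_mx_scalar.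
Qed.

Lemma neg_Lap_entry_mul (G : sgraph) (h : G -> R) x :
  \sum_y neg_Lap_entry x y * h y = - Lap h x.
Proof.
have delta z : \sum_y (z == y)%:R * h y = h z.
  rewrite (bigD1 z) //= eqxx mul1r big1 ?addr0 // => y.
  by rewrite eq_sym => /negPf ->; rewrite mul0r.
under eq_bigr do rewrite mulNr mulr_suml.
rewrite sumrN exchange_big; congr (- _); apply: eq_bigr => z _.
by under eq_bigr do rewrite mulrBl; rewrite sumrB !delta.
Qed.

Lemma char_poly_orthogonal_eigenfun (G : sgraph) n (e : 'I_n -> G)
    (h : 'I_n -> G -> R) (d : 'I_n -> R) :
  bijective e -> (forall i x, Lap (h i) x = - (d i * h i x)) ->
  (forall i j, i != j -> \sum_x h i x * h j x = 0) ->
  (forall i, \sum_x h i x * h i x != 0) ->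
  char_poly (neg_Lap_mx R G) = \prod_i ('X - (d i)%:P).
Proof.
move=> be eig orth norm; rewrite (neg_Lap_char_poly be).
pose P : 'M[R]_n := \matrix_(i, j) h j (e i).
have sum_e (F : G -> R) : \sum_i F (e i) = \sum_x F x.
  by rewrite [RHS](reindex e) //; exact: onW_bij.
rewrite (@char_poly_diagonalizable _ _ P (\row_i d i)).
- by apply: eq_bigr => i _; rewrite mxE.
(* Invertibility of [P] comes from its Gram matrix, which is diagonal with nonzero entries. *)
- have : P^T *m P = diag_mx (\row_i \sum_x h i x * h i x).
    apply/matrixP => i j; rewrite !mxE -(sum_e (fun x => _)).
    have [<-|ij] := eqVneq i j; first by apply: eq_bigr => k _; rewrite !mxE.
    rewrite mulr0n -[RHS](orth i j) // -sum_e.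
    by apply: eq_bigr => k _; rewrite !mxE.
  move=> /(congr1 determinant); rewrite det_mulmx det_diag unitmxE unitfE => detP.
  have : \prod_i (\row_i \sum_x h i x * h i x : 'rV[R]_n) 0 i != 0.
    by apply/prodf_neq0 => i _; rewrite mxE.
  by rewrite -detP mulf_eq0 negb_or => /andP[].
- apply/matrixP => i j; rewrite mul_mx_diag !mxE.
  under eq_bigr do rewrite !mxE.
  rewrite (sum_e (fun y => neg_Lap_entry (e i) y * h j y)) neg_Lap_entry_mul.
  by rewrite eig opprK mulrC.
Qed.

(** One eigenvalue 0 is split off and [t] is left unsorted, a form that passes to the prism by mere
    concatenation. *)
Definition spectral_gap2 (G : sgraph) : Prop :=
  exists2 t : seq R, all (fun a => 2 <= a) t &
    char_poly (neg_Lap_mx R G) = \prod_(a <- 0 :: t) ('X - a%:P).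

Lemma prism_spectrum (G : sgraph) s :
  char_poly (neg_Lap_mx R G) = \prod_(a <- s) ('X - a%:P) ->
  char_poly (neg_Lap_mx R (prism G)) =
  \prod_(a <- s ++ [seq a + 2 | a <- s]) ('X - a%:P).
Proof.
move=> sE; rewrite prism_char_poly sE big_cat big_map /=; congr (_ * _).
rewrite rmorph_prod; apply: eq_bigr => a _.
by rewrite /= comp_polyB comp_polyX comp_polyC (polyCD a) opprD addrA addrAC.
Qed.

Lemma prism_gap2 (G : sgraph) : spectral_gap2 G -> spectral_gap2 (prism G).
Proof.
move=> [t t_ge2 /prism_spectrum tE].
exists (t ++ [seq a + 2 | a <- 0 :: t]); last exact: tE.
rewrite all_cat t_ge2 /= add0r lexx all_map /=.
by apply: sub_all t_ge2 => a /=; lra.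
Qed.

Lemma prism_lambda1 (G : sgraph) : spectral_gap2 G -> is_lambda (prism G) 1 (2 : R).
Proof.
move=> [t t_ge2 /prism_spectrum /= tE].
pose t' := t ++ [seq a + 2 | a <- t].
have t'_ge2 : all (fun a => 2 <= a) t'.
  rewrite all_cat t_ge2 all_map /=.
  by apply: sub_all t_ge2 => a /=; lra.
(* The 2 is the shifted copy of the eigenvalue 0; all those in [t'] are at least 2, so sorting [t']
   alone suffices. *)
exists (0 :: 2 :: sort <=%R t'); split=> //; split.
  rewrite /= ler0n /= path_min_sorted ?sort_le_sorted //.
  by rewrite all_sort.
rewrite tE; apply: perm_big; rewrite perm_cons add0r.
by rewrite -cat1s perm_catCA perm_cons perm_sym perm_sort.
Qed.

End Spectrum.

(** * The base graph, complete on five vertices minus the edge between 0 and 1 *)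

Definition K5e_edge (i j : 'I_5) : bool :=
  (i != j :> nat) && ~~ ((i < 2) && (j < 2))%N.

Lemma K5e_sym : symmetric K5e_edge.
Proof. by move=> i j; rewrite /K5e_edge eq_sym andbC (andbC (j < 2)%N) andbC. Qed.

Lemma K5e_irr : irreflexive K5e_edge.
Proof. by move=> i; rewrite /K5e_edge eqxx. Qed.

Definition K5e : sgraph := SGraph K5e_sym K5e_irr.

Local Notation v0 := (@Ordinal 5 0 isT).
Local Notation v1 := (@Ordinal 5 1 isT).
Local Notation v2 := (@Ordinal 5 2 isT).
Local Notation v3 := (@Ordinal 5 3 isT).
Local Notation v4 := (@Ordinal 5 4 isT).

Lemma K5e_ind (P : K5e -> Prop) : P v0 -> P v1 -> P v2 -> P v3 -> P v4 ->
  forall x, P x.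
Proof.
move=> P0 P1 P2 P3 P4 [[|[|[|[|[|//]]]]] ltx];
  by rewrite (bool_irrelevance ltx isT).
Qed.

Section K5eSums.
Variable V : nmodType.
Implicit Type F : K5e -> V.

Lemma big_K5e F : \sum_(y : 'I_5) F y = F v0 + F v1 + F v2 + F v3 + F v4.
Proof.
rewrite !big_ord_recl big_ord0 addr0 !addrA.
by congr (F _ + F _ + F _ + F _ + F _); apply: val_inj.
Qed.

Lemma K5e_sum0 F : \sum_(y | @edge K5e v0 y) F y = F v2 + F v3 + F v4.
Proof. by rewrite big_mkcond big_K5e /= !add0r. Qed.

Lemma K5e_sum1 F : \sum_(y | @edge K5e v1 y) F y = F v2 + F v3 + F v4.
Proof. by rewrite big_mkcond big_K5e /= !add0r. Qed.

Lemma K5e_sum2 F : \sum_(y | @edge K5e v2 y) F y = F v0 + F v1 + F v3 + F v4.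
Proof. by rewrite big_mkcond big_K5e /= addr0. Qed.

Lemma K5e_sum3 F : \sum_(y | @edge K5e v3 y) F y = F v0 + F v1 + F v2 + F v4.
Proof. by rewrite big_mkcond big_K5e /= addr0. Qed.

Lemma K5e_sum4 F : \sum_(y | @edge K5e v4 y) F y = F v0 + F v1 + F v2 + F v3.
Proof. by rewrite big_mkcond big_K5e /= addr0. Qed.

End K5eSums.

Section K5eBase.
Variable R : realType.

Let K5e_sumE := (@K5e_sum0 R, @K5e_sum1 R, @K5e_sum2 R, @K5e_sum3 R, @K5e_sum4 R).

Lemma K5e_irregular : irregular K5e.
Proof.
move=> [k regk].
have : #|neighbours (v0 : K5e)| = 3.
  by rewrite cardsE -sum1_card; exact: (@K5e_sum0 nat).
have : #|neighbours (v2 : K5e)| = 4.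
  by rewrite cardsE -sum1_card; exact: (@K5e_sum2 nat).
by rewrite !regk => ->.
Qed.

Lemma K5e_connected : graph_connected K5e.
Proof.
split; first by rewrite card_ord.
have to2 (x : K5e) : connect K5e_edge x v2.
  elim/K5e_ind: x; [| |exact: connect0| |]; exact: connect1.
move=> x y; apply: connect_trans (to2 x) _.
by rewrite (sym_connect_sym K5e_sym).
Qed.

Lemma K5e_CD2 : CD_infty K5e (2 : R).
Proof.
have sq (z : R) := sqr_ge0 z.
(* Sums of squares equal to [12 * (Gamma2 f f x - 2 * Gamma f f x)] at a vertex
   [x] of degree 3 and to 8 times the same quantity at a vertex of degree 4. *)
have sos3 (x a p q r : R) :
    0 <= (3 * (a - x) - 2 * (p + q + r - 3 * x)) ^+ 2 + (p + q + r - 3 * x) ^+ 2 +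
         11 * ((p - q) ^+ 2 + (p - r) ^+ 2 + (q - r) ^+ 2).
  by do ![exact: ler0n | exact: sq | apply: addr_ge0 | apply: mulr_ge0].
have sos4 (x a b p q : R) :
    0 <= 4 * (a + b - p - q) ^+ 2 + 3 * (a + b - 2 * x) ^+ 2 +
         3 * (p + q - 2 * x) ^+ 2 + 3 * (a - b) ^+ 2 + 11 * (p - q) ^+ 2.
  by do ![exact: ler0n | exact: sq | apply: addr_ge0 | apply: mulr_ge0].
move=> f; elim/K5e_ind; rewrite /Gamma2 /Gamma /Lap !K5e_sumE.
(* In [sos3], [a] is the value at the only non-neighbour of the centre; in [sos4], [a] and [b] are
   the values at the two nonadjacent vertices. *)
- by have := sos3 (f v0) (f v1) (f v2) (f v3) (f v4); lra.
- by have := sos3 (f v1) (f v0) (f v2) (f v3) (f v4); lra.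
- by have := sos4 (f v2) (f v0) (f v1) (f v3) (f v4); lra.
- by have := sos4 (f v3) (f v0) (f v1) (f v2) (f v4); lra.
- by have := sos4 (f v4) (f v0) (f v1) (f v2) (f v3); lra.
Qed.

(** Since 2 is not an eigenvalue, the five linear equations have only the zero solution. *)
Lemma K5e_E2 (a : K5e -> R) : E2 a -> forall x, a x = 0.
Proof.
move=> Ea.
have := Ea v0; have := Ea v1.
have := Ea v2; have := Ea v3.
have := Ea v4.
rewrite /Lap !K5e_sumE => e4 e3 e2 e1 e0.
by elim/K5e_ind; lra.
Qed.

Lemma K5e_vis_regular : regular (Gvis R K5e) 0.
Proof.
move=> x; apply: eq_card0 => y; rewrite inE /= /vis_edge.
apply/negP => /andP[_ /asboolP[a Ea]].
by rewrite !(K5e_E2 Ea).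
Qed.

(** An orthogonal eigenbasis for 0, 3, 5, 5, 5: the constants, the difference across the deleted
    edge, the contrast between its two ends and the triangle, and two functions of mean zero on the
    triangle. *)
Let K5e_eigenfun (j : 'I_5) (x : K5e) : R :=
  (nth [::] [:: [:: 1; 1; 1; 1; 1]; [:: 1; -1; 0; 0; 0]; [:: 3; 3; -2; -2; -2];
                [:: 0; 0; 1; -1; 0]; [:: 0; 0; 1; 1; -2]] j)`_x.

Lemma K5e_gap2 : spectral_gap2 R K5e.
Proof.
exists [:: 3; 5; 5; 5]; first by rewrite /= !ler_nat.
rewrite (@char_poly_orthogonal_eigenfun _ K5e _ id K5e_eigenfun
          (fun i => [:: 0; 3; 5; 5; 5]`_i)).
- by rewrite (big_nth 0) big_mkord.
- by exists id.
- move=> j x; elim/K5e_ind: x; rewrite /Lap K5e_sumE /K5e_eigenfun;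
    by elim/K5e_ind: j => /=; lra.
- move=> i j; rewrite big_K5e /K5e_eigenfun.
  by elim/K5e_ind: i; elim/K5e_ind: j => //= _; lra.
- move=> i; rewrite big_K5e /K5e_eigenfun.
  by elim/K5e_ind: i => /=; apply: lt0r_neq0; lra.
Qed.

End K5eBase.

Theorem theorem7p6 (R : realType) (d : nat) (d_ge4 : (4 <= d)%N) :
  exists G : sgraph,
    [/\ graph_connected G, irregular G, CD_infty G (2 : R)
      & is_lambda G 1 (2 : R)] /\
    (regular (Gvis R G) d /\ ~ graph_iso (Gvis R G) (hypercube d)).
Proof.
pose G k := iter k prism K5e.
have conn k : graph_connected (G k).
  by elim: k => [|k]; [exact: K5e_connected | exact: prism_connected].
have irr k : irregular (G k).
  by elim: k => [|k]; [exact: K5e_irregular | exact: prism_irregular].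
have cd k : CD_infty (G k) (2 : R).
  by elim: k => [|k]; [exact: K5e_CD2 | exact: prism_CD2].
have gap k : spectral_gap2 R (G k).
  by elim: k => [|k]; [exact: K5e_gap2 | exact: prism_gap2].
have visreg k : regular (Gvis R (G k)) k.
  by elim: k => [|k]; [exact: K5e_vis_regular | exact/prism_vis_regular/conn].
have cardG k : #|G k| = (2 ^ k * 5)%N.
  elim: k => [|k IHk]; first by rewrite card_ord.
  by rewrite card_prod card_bool IHk expnS mulnA.
exists (G d); split; first split=> //.
  (* The eigenvalue 2 appears only with the first prism, so [d] must be a successor. *)
  by case: d d_ge4 => // d _; exact: prism_lambda1.
(* Counting vertices suffices: a bijection would give [2 ^ d * 5 = 2 ^ d]. *)
split=> // -[f /bij_eq_card card_f _]; move: card_f.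
rewrite [LHS]cardG [RHS]card_mx card_Fp // mul1n => /eqP.
by rewrite -[X in _ == X]muln1 eqn_pmul2l ?expn_gt0.
Qed.
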